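(* In linear networks (paths) with $n$ users, i.i.d. edge weights with $\Pr(w_{i,i+1}=v_k)=p_k$, $k=1,\dots,K$, and i.i.d. user quantities, the revised Algorithm 1 for multi-unit resource sharing runs in $O(\log n)$ time with high probability. That is, there is a constant $C$ (independent of $n$) such that the probability that the algorithm terminates within $C\log n$ iterations tends to $1$ as $n\to\infty$.
   Context: Linear network: users $u_1,\dots,u_n$, edges $e_i=\{u_i,u_{i+1}\}$ for $i=1,\dots,n-1$, with weight $w_{i,i+1}$ on $e_i$. Weights are i.i.d. with values in the finite set $\{v_1,\dots,v_K\}$, $0\le v_1<\cdots<v_K$, $\Pr(w_{i,i+1}=v_k)=p_k$, $\sum_kp_k=1$; $K$, the $v_k$ and the $p_k$ are fixed as $n\to\infty$. User $u_i$ has a positive integer quantity $q_i$; the quantities are i.i.d. Multi-unit allocation problem: maximize $\sum_{i=1}^{n-1}w_{i,i+1}x_{i,i+1}$ over nonnegative integers $x_{i,i+1}$ subject to $x_{i-1,i}+x_{i,i+1}\le q_i$ for $2\le i\le n-1$, $x_{1,2}\le q_1$, $x_{n-1,n}\le q_n$. Revised (multi-unit) Algorithm 1: initially all $x_{i,i+1}=0$ and each user's remaining quantity is $q_i$; a user is available while its remaining quantity is positive. Each iteration has two phases. Proposal phase: every available user having at least one available neighbor sends a proposal to the available neighbor to which it is joined by the edge of largest weight; nodes are assigned unique numbers, and ties are broken in favor of the neighbor with the highest number. Matching phase: for every pair $u_i,u_{i+1}$ that proposed to each other, $x_{i,i+1}$ is increased by the minimum of the two remaining quantities, and both remaining quantities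 are decreased by the same amount. The algorithm stops when no available user has an available neighbor. All users act in parallel, and one unit of time is one iteration.
   Formalization: The formal theorem also assumes p_k < 1 for every k (weights not deterministic); otherwise the claim fails: with all weights equal, all quantities 1 and users numbered left to right, only one pair matches per iteration, so about n/2 iterations are needed. *)

(* Defs.v *)
From mathcomp Require Import all_boot all_order all_algebra.
From mathcomp Require Import all_classical all_reals all_analysis.

Set Implicit Arguments.
Unset Strict Implicit.
Unset Printing Implicit Defensive.

Import Order.TTheory GRing.Theory Num.Theory.
Import numFieldNormedType.Exports.

Local Open Scope ring_scope.

Section Path.
Variable n : nat.

(* Users are indexed from 0: edge e joins users e and e.+1.  For n <= 1 there
   is no edge. *)
Definition user := 'I_n.
Definition edge := 'I_n.-1.

Definition lend (e : edge) : user := widen_ord (leq_pred n) e.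

Lemma rend_subproof (e : edge) : (e.+1 < n)%N.
Proof. by rewrite -ltn_predRL. Qed.

Definition rend (e : edge) : user := Ordinal (rend_subproof e).

Definition incident (i : user) (e : edge) : bool :=
  (i == lend e) || (i == rend e).

(* The endpoint of e different from i; only meaningful if incident i e. *)
Definition other (i : user) (e : edge) : user :=
  if i == lend e then rend e else lend e.

End Path.

Section Algorithm.
Variables (R : realType) (n : nat).
Variables (w : edge n -> R) (num : user n -> nat).

Record state := State {
  alloc : edge n -> nat ;
  remaining : user n -> nat }.

Definition init (q : user n -> nat) : state := State (fun=> 0%N) q.

Definition available (s : state) (i : user n) : bool := (0 < remaining s i)%N.

(* On a path, the neighbors of user i are named by the edges incident to i. *)
Definition candidate (s : state) (i : user n) (e : edge n) : bool :=
  [&& incident i e, available s i & available s (other i e)].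

Definition preferred (i : user n) (e e' : edge n) : bool :=
  (w e' < w e) || (w e' == w e) && (num (other i e') < num (other i e))%N.

Definition proposes (s : state) (i : user n) (e : edge n) : bool :=
  candidate s i e &&
  [forall e', candidate s i e' ==> (e' != e) ==> preferred i e e'].

Definition matched (s : state) (e : edge n) : bool :=
  proposes s (lend e) e && proposes s (rend e) e.

Definition transfer (s : state) (e : edge n) : nat :=
  if matched s e then minn (remaining s (lend e)) (remaining s (rend e)) else 0%N.

(* A user sends at most one proposal, so the sum below has at most one nonzero
   term and the truncated subtraction is exact. *)
Definition step (s : state) : state :=
  State (fun e => alloc s e + transfer s e)%N
        (fun i => remaining s i - \sum_(e | incident i e) transfer s e)%N.

Definition stopped (s : state) : bool :=
  [forall i, forall e, ~~ candidate s i e].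

(* The real bound b on the number of iterations need not be an integer. *)
Definition terminates_within (q : user n -> nat) (b : R) : Prop :=
  exists2 t : nat, t%:R <= b & stopped (iter t step (init q)).

End Algorithm.

Section Iid.
Context d d' (T : measurableType d) (T' : measurableType d') (R : realType).
Variables (P : probability T R) (I : finType) (X : I -> {RV P >-> T'}).

Local Open Scope classical_set_scope.
Local Open Scope ereal_scope.

Definition mutually_independent : Prop :=
  forall (J : {set I}) (B : I -> set T'), (forall i, measurable (B i)) ->
    P (\bigcap_(i in [set` J]) (X i @^-1` B i)) =
    \prod_(i in J) P (X i @^-1` B i).

Definition identically_distributed : Prop :=
  forall (i j : I) (B : set T'), measurable B ->
    distribution P (X i) B = distribution P (X j) B.

Definition iid : Prop := mutually_independent /\ identically_distributed.

End Iid.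

(* Main.v *)
(* If an edge is still active (both endpoints available) after an iteration, it
   was not matched, so one of its endpoints prefers an adjacent edge that was
   active too.  Hence an edge active after t iterations starts a chain of t+1
   successively preferred edges.  Preference at a common endpoint is asymmetric,
   so the chain never turns back on the path, and the weights are nondecreasing
   along it.  With K values and t = K m, some m consecutive edges share the same
   weight.  If every p_k <= rho < 1, this has probability at most n K rho^m,
   which is O(1/n) for m = floor(2 ln n / ln (1/rho)). *)

Require Import Defs.
From mathcomp Require Import all_boot all_order all_algebra.
From mathcomp Require Import all_classical all_reals all_analysis.
From mathcomp Require Import zify ring lra.

Import Order.TTheory GRing.Theory Num.Theory.
Import numFieldNormedType.Exports.

Set Implicit Arguments.
Unset Strict Implicit.
Unset Printing Implicit Defensive.

Local Open Scope classical_set_scope.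
Local Open Scope ring_scope.

(** * Deterministic dynamics: active edges and preference chains *)

Section Dynamics.
Variables (R : realType) (n : nat).
Variables (w : edge n -> R) (num : user n -> nat).
Hypothesis num_inj : injective num.
Implicit Types (s : state n) (i : user n) (e f : edge n).

Definition active s e := available s (lend e) && available s (rend e).

Lemma candidateE s i e : candidate s i e = incident i e && active s e.
Proof.
rewrite /candidate /incident /active /other.
have [->|nl] := eqVneq i (lend e); first by rewrite orTb.
by rewrite orFb; have [->|] := eqVneq i (rend e) => //=; rewrite andbC.
Qed.

Lemma stoppedE s : stopped s = [forall e, ~~ active s e].
Proof.
apply/forallP/forallP => [H e|H i].
  by have /forallP/(_ e) := H (lend e); rewrite candidateE /incident eqxx.
by apply/forallP => e; rewrite candidateE negb_and H orbT.
Qed.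

(** Remaining quantities never increase, and a match transfers the smaller of the two, which
    exhausts one endpoint. *)
Lemma active_step s e :
  active (step w num s) e -> active s e && ~~ matched w num s e.
Proof.
have incl : incident (lend e) e by rewrite /incident eqxx.
have incr : incident (rend e) e by rewrite /incident eqxx orbT.
rewrite /active /available /= (bigD1 e) //= [X in _ && (0 < _ - X)%N](bigD1 e) //=.
by rewrite {1 3}/transfer; case: matched; lia.
Qed.

(** One link of the chain. The negated preference is what a missing proposal provides; for injective
    [num] it means that [i] strictly prefers [f]. *)
Definition dominated e f := exists i,
  [/\ incident i e, incident i f, f != e & ~~ preferred w num i e f].

Lemma unmatched_dominated s e : active s e -> ~~ matched w num s e ->
  exists2 f, active s f & dominated e f.
Proof.
move=> ae; have unprop i : incident i e -> ~~ proposes w num s i e ->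
    exists2 f, active s f & dominated e f.
  move=> ie; rewrite /proposes candidateE ie ae /= negb_forall => /existsP[f].
  rewrite !negb_imply candidateE => /andP[/andP[jf af] /andP[fe np]].
  by exists f => //; exists i.
by rewrite negb_and => /orP[]; apply: unprop; rewrite /incident eqxx ?orbT.
Qed.

Lemma dominated_le e f : dominated e f -> w e <= w f.
Proof. by move=> [i [_ _ _]]; rewrite negb_or -leNgt => /andP[]. Qed.

Lemma dominated_adjacent e f : dominated e f -> f = e.+1 :> nat \/ e = f.+1 :> nat.
Proof.
move=> [i [ie jf fe _]]; move: ie jf; rewrite /incident -!val_eqE /=.
by move: fe; rewrite -val_eqE /=; lia.
Qed.

Lemma incident_unique e f i j : f != e -> incident i e -> incident i f ->
  incident j e -> incident j f -> i = j.
Proof.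
by rewrite /incident => fe ie jf je jf'; apply/val_inj => /=;
  move: fe ie jf je jf'; rewrite -!val_eqE /=; lia.
Qed.

Lemma other_inj i e f : incident i e -> incident i f -> other i e = other i f ->
  e = f.
Proof.
move=> ie jf /(congr1 val); rewrite /other => H; apply/val_inj.
by move: ie jf H; rewrite /incident -!val_eqE /=; do 2!case: ifP => /=; lia.
Qed.

(** Two distinct edges of a path share at most one user, so both comparisons take place there. They
    force equal weights, then equal numbers, against injectivity of [num]. *)
Lemma dominated_asym e f : dominated e f -> ~ dominated f e.
Proof.
move=> [i [ie jf fe npi]] [j [je ij ef npj]].
move: npj; rewrite -(incident_unique fe ie jf ij je) => npi'.
move: npi npi'; rewrite /preferred !negb_or -!leNgt !negb_and.
move=> /andP[le1 o1] /andP[le2 o2].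
have wE : w e = w f by apply/le_anti/andP.
move: o1 o2; rewrite wE eqxx /= -!leqNgt => o1 o2.
have /num_inj /(other_inj ie jf) E : num (other i e) = num (other i f).
  by apply/eqP; rewrite eqn_leq o1 o2.
by rewrite E eqxx in fe.
Qed.

(** The chain runs backwards in time: the edge dominating [e] in the last iteration was active one
    iteration earlier and starts the remaining links. *)
Lemma active_chain s t e : active (iter t (step w num) s) e ->
  exists g : nat -> edge n,
    g 0%N = e /\ forall j, (j < t)%N -> dominated (g j) (g j.+1).
Proof.
elim: t e => [|t IH] e; first by exists (fun=> e).
rewrite iterS => /active_step /andP[ae nm].
have [f /IH[g [g0 gS]] ef] := unmatched_dominated ae nm.
exists (fun j => if j is j'.+1 then g j' else e); split => // -[|j] jt.
  by rewrite g0.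
exact: gS.
Qed.

(** Each link moves the index by one, and asymmetry rules out returning to the previous edge, so the
    first direction persists. *)
Lemma chain_straight (g : nat -> edge n) t :
    (forall j, (j < t)%N -> dominated (g j) (g j.+1)) ->
  (forall j, (j <= t)%N -> g j = g 0%N + j :> nat)%N \/
  (forall j, (j <= t)%N -> g j + j = g 0%N :> nat)%N.
Proof.
move=> gS.
have turn j : (j.+1 < t)%N -> g j.+2 <> g j :> nat.
  move=> jt /val_inj E; have := gS _ jt; rewrite E.
  by apply/dominated_asym/gS/ltnW.
have adj j : (j < t)%N -> g j.+1 = (g j).+1 :> nat \/ g j = (g j.+1).+1 :> nat.
  by move=> /gS/dominated_adjacent.
clear gS; case: t => [|t] in turn adj *.
  by left=> j; rewrite leqn0 => /eqP->; rewrite addn0.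
have [up|dn] := adj 0%N isT; [left|right].
- have {}up j : (j < t.+1)%N -> g j.+1 = (g j).+1 :> nat.
    elim: j => // j IH jt; have := turn _ jt; have := IH (ltnW jt).
    by have := adj _ jt; lia.
  by elim=> [|j IH jt]; [lia|rewrite up // IH; lia].
- have {}dn j : (j < t.+1)%N -> g j = (g j.+1).+1 :> nat.
    elim: j => // j IH jt; have := turn _ jt; have := IH (ltnW jt).
    by have := adj _ jt; lia.
  elim=> [|j IH jt]; first lia.
  by have := dn _ jt; have := IH (ltnW jt); lia.
Qed.

End Dynamics.

(** * Blocks of consecutive edges of equal weight *)

(* With at most K values, a nondecreasing sequence must stay constant on one of
   the K blocks [jm, (j+1)m]. *)
Lemma nondecreasing_plateau K m (h : nat -> 'I_K) :
  (forall j, (j < K * m)%N -> (h j <= h j.+1)%N) ->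
  exists2 a, (a + m <= K * m)%N & forall j, (j <= m)%N -> h (a + j)%N = h a.
Proof.
move=> hS.
have mono i j : (i + j <= K * m)%N -> (h i <= h (i + j))%N.
  elim: j => [|j IH] ij; first by rewrite addn0.
  rewrite addnS in ij *; exact: leq_trans (IH (ltnW ij)) (hS _ ij).
have [/existsP[j /eqP hj]|/existsPn grow] :=
  boolP [exists j : 'I_K, h (j * m)%N == h (j.+1 * m)%N].
  have jK : (j * m + m <= K * m)%N by rewrite -mulSnr leq_mul2r ltn_ord orbT.
  exists (j * m)%N => // i im; apply/val_inj/eqP; rewrite eqn_leq.
  rewrite mono ?andbT; last lia.
  rewrite [X in (_ <= X)%N](congr1 val hj) /= mulSnr.
  have -> : (j * m + m = j * m + i + (m - i))%N by lia.
  by apply: mono; lia.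
(* Otherwise [h] gains at least one on every block and would reach [K], which is outside ['I_K]. *)
have far j : (j <= K)%N -> (j <= h (j * m))%N.
  elim: j => // j IH jK; apply: leq_ltn_trans (IH (ltnW jK)) _.
  have := grow (Ordinal jK); rewrite -val_eqE /= mulSnr.
  have : (j * m + m <= K * m)%N by rewrite -mulSnr leq_mul2r jK orbT.
  by move=> /mono; lia.
by have := far K (leqnn K); rewrite leqNgt ltn_ord.
Qed.

Definition block n (m : nat) (a : edge n) : {set edge n} :=
  [set e : edge n | (a <= e < a + m)%N]%SET.

Lemma card_block n m (a : edge n) : (a + m <= n.-1)%N -> #|block m a| = m.
Proof.
move=> am.
have lt (j : 'I_m) : (a + j < n.-1)%N by apply: leq_trans am; rewrite ltn_add2l.
have -> : block m a = [set Ordinal (lt j) | j in 'I_m]%SET.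
  apply/setP => e; rewrite inE; apply/idP/imsetP.
    move=> /andP[ae em]; have em' : (e - a < m)%N by lia.
    by exists (Ordinal em') => //; apply/val_inj => /=; rewrite subnKC.
  by case=> j _ ->; rewrite /= leq_addr ltn_add2l ltn_ord.
rewrite card_imset ?card_ord // => i j /(congr1 val) /= /addnI.
exact: val_inj.
Qed.

Lemma running_monochromatic_block (R : realType) n K (v : 'I_K -> R)
    (w : edge n -> R) (kap : edge n -> 'I_K) (num : user n -> nat) m s :
    injective num -> (forall k l : 'I_K, (k < l)%N -> v k < v l) ->
    (forall e, w e = v (kap e)) ->
    ~~ stopped (iter (K * m) (step w num) s) ->
  exists (a : edge n) (k : 'I_K), (a + m <= n.-1)%N /\
    forall e : edge n, e \in block m a -> w e = v k.
Proof.
move=> num_inj v_incr wE.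
rewrite stoppedE negb_forall => /existsP[e0]; rewrite negbK => /active_chain.
move=> [g [_ gS]].
have le_kap e f : w e <= w f -> (kap e <= kap f)%N.
  by rewrite !wE leqNgt; apply: contraTN => /v_incr; rewrite ltNge.
have [a am const] : exists2 a, (a + m <= K * m)%N &
    forall j, (j <= m)%N -> kap (g (a + j)%N) = kap (g a).
  apply: (@nondecreasing_plateau K m (fun j => kap (g j))) => j jt.
  exact/le_kap/(dominated_le (gS j jt)).
(* The plateau has [m + 1] edges. The block takes the [m] lowest, so that it starts at [g a] on a
   rightward chain and at [g (a + m)] on a leftward one. *)
have [gE|gE] := chain_straight num_inj gS.
- have ga : (g a = g 0 + a :> nat)%N by apply: gE; lia.
  have gam : (g (a + m) = g 0 + (a + m) :> nat)%N by apply: gE; lia.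
  exists (g a), (kap (g a)); split.
    by have := ltn_ord (g (a + m)%N); lia.
  move=> e; rewrite inE => /andP[ae em]; rewrite wE; congr v.
  rewrite -(const (e - g a)%N); last lia.
  congr kap; apply/val_inj => /=; have := gE (a + (e - g a))%N; lia.
- have ga : (g a + a = g 0)%N by apply: gE; lia.
  have gam : (g (a + m) + (a + m) = g 0)%N by apply: gE; lia.
  exists (g (a + m)%N), (kap (g a)); split.
    by have := ltn_ord (g a); lia.
  move=> e; rewrite inE => /andP[ae em]; rewrite wE; congr v.
  rewrite -(const (g a - e)%N); last lia.
  congr kap; apply/val_inj => /=; have := gE (a + (g a - e))%N; lia.
Qed.

(** * Measurability and the union bound *)

Lemma measurable_countable_preimage d (T : measurableType d) (A : countType)
    (X : T -> A) (D : set A) :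
  (forall a, measurable (X @^-1` [set a])) -> measurable (X @^-1` D).
Proof.
(* The set [[set t | D a]] does not depend on [t]: it is full or empty and selects the values [a] in
   [D]. *)
move=> mX; have -> : X @^-1` D = \bigcup_a (X @^-1` [set a] `&` [set t | D a]).
  by apply/seteqP; split=> [t Dt|t [a _ [/= <-]]] //; exists (X t).
apply: countable_bigcupT_measurable => [|a]; first exact: countableP.
have [Da|nDa] := pselect (D a).
  by rewrite (_ : [set t | D a] = setT) ?setIT//; apply/seteqP; split.
by rewrite (_ : [set t | D a] = set0) ?setI0//; apply/seteqP; split.
Qed.

Lemma measure_bigsetU_le d (T : measurableType d) (R : realType)
    (P : probability T R) (I : Type) (r : seq I) (F : I -> set T) (c : R) :
  (forall i, measurable (F i)) -> (forall i, P (F i) <= c%:E)%E ->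
  (P (\big[setU/set0]_(i <- r) F i) <= ((size r)%:R * c)%:E)%E.
Proof.
move=> mF Fc; elim: r => [|i r IH]; first by rewrite big_nil measure0 mul0r.
rewrite big_cons /= -natr1 mulrDl mul1r addrC EFinD.
apply: le_trans (leeD (Fc i) IH).
by apply: measureU2 => //; apply: bigsetU_measurable.
Qed.

Section Bound.
Context d (T : measurableType d) (R : realType) (P : probability T R).
Variables (n K : nat) (v p : 'I_K -> R) (w : edge n -> {RV P >-> R}).
Variables (q : user n -> {RV P >-> nat}) (num : user n -> nat).
Hypothesis v_incr : forall k l : 'I_K, (k < l)%N -> v k < v l.
Hypothesis w_val : forall e t, exists k, w e t = v k.
Hypothesis w_law : forall e k, P (w e @^-1` [set v k]) = (p k)%:E.
Hypothesis w_ind : mutually_independent w.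
Hypothesis num_inj : injective num.

(** Level indices replace real weights, so that an input of the algorithm ranges over a countable
    type. *)
Let kap (e : edge n) (t : T) : 'I_K := projT1 (cid (w_val e t)).

Let kapE e t : w e t = v (kap e t).
Proof. exact: (projT2 (cid (w_val e t))). Qed.

Let measurable_level e k : measurable (w e @^-1` [set v k]).
Proof. by apply: measurable_funPTI. Qed.

Let v_inj : injective v.
Proof.
move=> k l vkl; have [/v_incr|/v_incr|kl] := ltngtP k l.
- by rewrite vkl ltxx.
- by rewrite vkl ltxx.
- exact: val_inj.
Qed.

(** The run is a function of the level indices and the quantities, which together take countably
    many values, each on a measurable set. *)
Lemma measurable_termination b :
  measurable [set t | terminates_within (fun e => w e t) num (fun i => q i t) b].
Proof.
pose X t : {ffun edge n -> 'I_K} * {ffun user n -> nat} :=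
  ([ffun e => kap e t], [ffun i => q i t]).
pose D := [set x : {ffun edge n -> 'I_K} * {ffun user n -> nat} |
  terminates_within (fun e => v (x.1 e)) num x.2 b].
rewrite (_ : [set t | _] = X @^-1` D).
  apply: measurable_countable_preimage => -[k r].
  rewrite (_ : _ @^-1` _ = (\bigcap_(e in setT) (w e @^-1` [set v (k e)])) `&`
    (\bigcap_(i in setT) (q i @^-1` [set r i]))).
    apply: measurableI; apply: fin_bigcap_measurable => [|i _];
      [exact: finite_finset|exact: measurable_level|exact: finite_finset|].
    exact: measurable_funPTI.
  apply/seteqP; split=> t /=.
    move=> [/ffunP kE /ffunP rE]; split=> i _ /=.
      by have := kE i; rewrite ffunE kapE => ->.
    by have := rE i; rewrite ffunE.
  move=> [kE rE]; congr pair; apply/ffunP => i; rewrite ffunE.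
    by apply: v_inj; rewrite -kapE; apply: kE.
  exact: rE.
apply: eq_set => t; rewrite /X /D /=.
have -> : (fun e => v ([ffun e' => kap e' t] e)) = (fun e => w e t).
  by apply/funext => e; rewrite ffunE kapE.
have -> // : ([ffun i => q i t] : user n -> nat) = (fun i => q i t).
by apply/funext => i; rewrite ffunE.
Qed.

Lemma probability_termination_ge m b rho :
    0 <= rho -> (forall k, p k <= rho) -> (K * m)%:R <= b ->
  ((1 - (n * K)%:R * rho ^+ m)%:E <=
   P [set t | terminates_within (fun e => w e t) num (fun i => q i t) b])%E.
Proof.
move=> rho_ge0 prho Kmb.
(* Blocks overrunning the path have fewer than [m] edges and a weaker bound; they get the empty
   event. *)
pose mono (x : edge n * 'I_K) : set T :=
  if (x.1 + m <= n.-1)%N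
  then \bigcap_(e in [set` block m x.1]) (w e @^-1` [set v x.2]) else set0.
pose bad := \big[setU/set0]_(x <- enum {: edge n * 'I_K}) mono x.
have mmono x : measurable (mono x).
  rewrite /mono; case: ifP => // _; apply: fin_bigcap_measurable => [|e _].
    exact: finite_finset.
  exact: measurable_level.
have mbad : measurable bad by apply: bigsetU_measurable.
have Pmono x : (P (mono x) <= (rho ^+ m)%:E)%E.
  rewrite /mono; case: ifPn => [xm|_]; last by rewrite measure0 lee_fin exprn_ge0.
  rewrite (w_ind (block m x.1) (fun=> measurable_set1 (v x.2))).
  under eq_bigr do rewrite w_law.
  rewrite prodEFin lee_fin prodr_const card_block //.
  (* Nonnegativity of [p x.2] comes from its being the probability of an event on the edge [x.1]. *)
  by rewrite lerXn2r ?nnegrE // -lee_fin -(w_law x.1).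
have Pbad : (P bad <= ((n * K)%:R * rho ^+ m)%:E)%E.
  apply: le_trans (measure_bigsetU_le _ mmono Pmono) _.
  rewrite -cardE card_prod !card_ord lee_fin.
  by rewrite ler_wpM2r ?exprn_ge0 // ler_nat leq_mul2r leq_pred orbT.
apply: (@le_trans _ _ (P (~` bad))).
  by rewrite probability_setC // EFinB; apply: leeB.
apply: le_measure; rewrite ?inE; [exact: measurableC|exact: measurable_termination|].
(* By contraposition: a run still going after [K * m] iterations has a block of [m] equal weights,
   hence is in [bad]. *)
move=> t nbad; exists (K * m)%N => //; apply: contrapT => /negP run; apply: nbad.
have [a [k [am kE]]] :=
  running_monochromatic_block num_inj v_incr (fun e => kapE e t) run.
rewrite /bad -bigcup_seq; exists (a, k); first by rewrite /= mem_enum.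
by rewrite /mono /= am => e; apply: kE.
Qed.

End Bound.

(** * Asymptotics in the number of users *)

(** Without truncation the power would be exactly [n%:R^-2]; truncating lowers the exponent by less
    than one, which costs at most a factor [rho^-1]. *)
Lemma expr_truncn_ln_le (R : realType) (rho : R) (n : nat) :
  0 < rho < 1 -> (0 < n)%N ->
  rho ^+ Num.truncn (2 / - ln rho * ln n%:R) <= rho^-1 * n%:R^-2.
Proof.
move=> /andP[rho0 rho1] n0; set m := Num.truncn _.
have L0 : ln rho < 0 by rewrite ln_lt0 // rho0 rho1.
have n0' : (0 : R) < n%:R by rewrite ltr0n.
have rhoE : rho = expR (ln rho) by rewrite lnK.
have nE : n%:R = expR (ln n%:R) :> R by rewrite lnK.
rewrite {1 2}rhoE {1}nE -!expRM_natl -!expRN -expRD ler_expR.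
have : 2 / - ln rho * ln n%:R < m.+1%:R by exact: truncnS_gt.
rewrite mulrAC ltr_pdivrMr ?oppr_gt0 // -natr1; lra.
Qed.

Theorem lemma2 (R : realType)
  (K : nat) (v p : 'I_K -> R)
  (v_ge0 : forall k, 0 <= v k)
  (v_incr : forall k l : 'I_K, (k < l)%N -> v k < v l)
  (p_sum : \sum_(k < K) p k = 1)
  (p_lt1 : forall k, p k < 1)
  (d : nat -> measure_display) (T : forall n, measurableType (d n))
  (P : forall n, probability (T n) R)
  (w : forall n, edge n -> {RV (P n) >-> R})
  (q : forall n, user n -> {RV (P n) >-> nat})
  (num : forall n, user n -> nat)
  (w_val : forall n e t, exists k, w n e t = v k)
  (w_law : forall n e k, P n (w n e @^-1` [set v k]) = (p k)%:E)
  (w_iid : forall n, iid (w n))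
  (q_pos : forall n i t, (0 < q n i t)%N)
  (q_iid : forall n, iid (q n))
  (num_inj : forall n, injective (num n)) :
  exists C : R,
    (fun n : nat =>
       P n [set t | terminates_within (fun e => w n e t) (num n)
                      (fun i => q n i t) (C * ln n%:R)])
      @ \oo --> 1%E.
Proof.
(* The default 1/2 makes [rho] positive at once, as [ln rho] and [rho^-1] require, and keeps it
   below 1. *)
pose rho : R := \big[Num.max/2^-1]_(k < K) p k.
have rho_lt1 : rho < 1.
  by apply: bigmax_lt => //; rewrite invf_lt1 ?ltr1n.
have rho_gt0 : 0 < rho.
  by apply: (@lt_le_trans _ _ 2^-1); rewrite ?invr_gt0 //; apply: bigmax_ge_id.
have p_le k : p k <= rho by apply: le_bigmax.
have A_ge0 : 0 <= 2 / - ln rho.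
  by rewrite divr_ge0 // oppr_ge0 ln_le0 // ltW.
exists (K%:R * (2 / - ln rho)).
(* The failure bound is [K / (rho * n)]; the factor 2 pays for replacing [1/n] by the harmonic term
   [1/(n+1)], since [n + 1 <= 2n] for positive [n]. *)
pose c := K%:R / rho * 2.
apply: (@squeeze_cvge _ _ _ _ (fun n => (1 - c * n.+1%:R^-1)%:E) _ (fun=> 1%E)).
- near=> n.
  have n_gt0 : (0 < n)%N by near: n; exact: nbhs_infty_gt.
  have [w_ind _] := w_iid n.
  have mE := measurable_termination (q n) (num n) v_incr (w_val n).
  rewrite [X in _ && X]probability_le1 // andbT.
  pose m := Num.truncn (2 / - ln rho * ln n%:R).
  apply: le_trans (probability_termination_ge (m := m) (q n) v_incr (w_val n)
    (w_law n) w_ind (num_inj n) (ltW rho_gt0) p_le _); last first.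
    rewrite natrM -mulrA ler_wpM2l // truncn_le // mulr_ge0 //.
    by rewrite ln_ge0 // ler1n.
  have rm : rho ^+ m <= rho^-1 * n%:R^-2.
    by apply: expr_truncn_ln_le => //; rewrite rho_gt0.
  rewrite lee_fin lerB // natrM.
  apply: le_trans (ler_wpM2l _ rm) _; first by rewrite mulr_ge0.
  have n0 : (0 : R) < n%:R by rewrite ltr0n.
  have -> : n%:R * K%:R * (rho^-1 * n%:R^-2) = K%:R / rho * n%:R^-1.
    by field; rewrite !gt_eqF.
  rewrite /c -[leRHS]mulrA; apply: ler_wpM2l; first by rewrite divr_ge0 // ltW.
  rewrite ler_pdivlMr ?ltr0n // mulrC ler_pdivrMr //.
  by rewrite -natrM ler_nat mul2n -addnn -addn1 leq_add2l.
- apply: cvg_EFin; first exact: nearW.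
  rewrite -[X in _ --> X]subr0 -[X in _ --> _ - X](mulr0 c).
  by apply: cvgB; [exact: cvg_cst|apply: cvgMr; exact: cvg_harmonic].
- exact: cvg_cst.
Unshelve. all: by end_near.
Qed.
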